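(* Let $E$ be a separable Baire locally convex space and let $Y$ be the $\Sigma$-product, with base point $0$, of any family $\{E_\alpha:\alpha\in A\}$ of separable Fréchet spaces. Then the product $E\times Y$ is Weak Asplund.
   Context: All vector spaces are over $\mathbb{R}$ and all topological vector spaces are Hausdorff. A Fréchet space is a completely metrizable locally convex space. A topological space is Baire if the intersection of every countable sequence of its dense open subsets is dense; a locally convex space is Baire if its underlying topological space is. The $\Sigma$-product with base point $0$ of a family $\{E_\alpha:\alpha\in A\}$ of locally convex spaces is the subspace of $\prod_{\alpha\in A}E_\alpha$ consisting of all $x=(x_\alpha)$ with $x_\alpha=0$ for all but countably many $\alpha$, with the topology induced from the product topology; it is a locally convex space. Let $X$ be a locally convex space with continuous dual $X'$ and let $D\subset X$ be a nonempty open convex set. A convex function $f:D\to\mathbb{R}$ is Gâteaux differentiable at $x_0\in D$ if there is a continuous linear functional $f'(x_0)\in X'$ such that for every $x\in X$ and $\epsilon>0$ there is $\delta>0$ such that $\left|\frac{f(x_0+tx)-f(x_0)}{t}-\langle f'(x_0),x\rangle\right|<\epsilon$ whenever $0<|t|<\delta$ (with $\delta$ small enough that $x_0+tx\in D$). A locally convex space $X$ is Weak Asplund (WASP) if for every nonempty open convex $D\subset X$, every continuous convex function $f:D\to\mathbb{R}$ is Gâteaux differentiable at every point of some dense $G_\delta$ subset of $D$. *)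

(* Defs.v *)
From HB Require Import structures.
From mathcomp Require Import all_boot all_order all_algebra.
From mathcomp Require Import all_classical all_reals all_analysis.
From mathcomp Require Import borel_hierarchy.

Set Implicit Arguments.
Unset Strict Implicit.
Unset Printing Implicit Defensive.

Import Order.TTheory GRing.Theory Num.Theory.
Import numFieldNormedType.Exports.

Local Open Scope classical_set_scope.
Local Open Scope ring_scope.

Section topological_notions.
Context (T : topologicalType).

Definition separable_space := exists2 S : set T, countable S & dense S.

Definition baire_space := forall U : (set T)^nat,
  (forall n, open (U n) /\ dense (U n)) -> dense (\bigcap_n U n).

End topological_notions.

(* The metric is only required to induce the topology: the uniform structure
   carried by a tvsType is not assumed to be the translation-invariant one, so
   completeness is not expressed through it. *)
Definition completely_metrizable (R : realType) (T : topologicalType) :=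
  exists d : T -> T -> R,
    [/\ forall x y, (d x y = 0) <-> (x = y),
        forall x y, d x y = d y x,
        forall x y z, d x z <= d x y + d y z,
        forall x (U : set T), nbhs x U <->
          exists2 e : R, 0 < e & [set y | d x y < e] `<=` U
      & forall u : nat -> T,
          (forall e : R, 0 < e -> exists N, forall m n,
             (N <= m)%N -> (N <= n)%N -> d (u m) (u n) < e) ->
          exists x : T, u n @[n --> \oo] --> x].

Definition frechet_space (R : realType) (X : tvsType R) :=
  completely_metrizable R X.

(* f stands for a function on D: its values outside D play no role. *)
Definition gateaux_differentiable (R : realType) (X : tvsType R) (D : set X)
    (f : X -> R) (x0 : X) :=
  exists2 df : {linear X -> R^o}, continuous df &
    forall (x : X) (e : R), 0 < e ->
      exists2 delta : R, 0 < delta &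
        forall t : R, 0 < `|t| -> `|t| < delta ->
          D (x0 + t *: x) /\
          `| (f (x0 + t *: x) - f x0) / t - df x | < e.

(* "Dense" and "G_delta" refer to the subspace topology of D, which is that of
   the type associated with the set D. *)
Definition weak_asplund (R : realType) (X : tvsType R) :=
  forall (D : set X), D !=set0 -> open D -> convex_set D ->
  forall f : X -> R, {within D, continuous f} -> convex_function D f ->
  exists G : set (set_type D),
    [/\ Gdelta G, dense G &
        forall x, G x -> gateaux_differentiable D f (set_val x)].

Section prod_topology_tvs.
Context (R : realType) (A : Type) (E : A -> tvsType R).
Local Notation P := (prod_topology E).

Let padd (x y : P) : P := fun a => x a + y a.
Let popp (x : P) : P := fun a => - x a.
Let pzero : P := fun=> 0.
Let pscale (k : R) (x : P) : P := fun a => k *: x a.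

Let paddA : associative padd.
Proof. by move=> x y z; apply: functional_extensionality_dep => a; exact: addrA. Qed.
Let paddC : commutative padd.
Proof. by move=> x y; apply: functional_extensionality_dep => a; exact: addrC. Qed.
Let padd0 : left_id pzero padd.
Proof. by move=> x; apply: functional_extensionality_dep => a; exact: add0r. Qed.
Let paddN : left_inverse pzero popp padd.
Proof. by move=> x; apply: functional_extensionality_dep => a; exact: addNr. Qed.

HB.instance Definition _ :=
  GRing.isZmodule.Build P paddA paddC padd0 paddN.

Let pscaleA a b v : pscale a (pscale b v) = pscale (a * b) v.
Proof. by apply: functional_extensionality_dep => i; exact: scalerA. Qed.
Let pscale1 : left_id 1 pscale.
Proof. by move=> x; apply: functional_extensionality_dep => a; exact: scale1r. Qed.
Let pscaleDr : right_distributive pscale +%R.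
Proof. by move=> k x y; apply: functional_extensionality_dep => a; exact: scalerDr. Qed.
Let pscaleDl v : {morph pscale^~ v : a b / a + b}.
Proof. by move=> k l; apply: functional_extensionality_dep => a; exact: scalerDl. Qed.

HB.instance Definition _ :=
  GRing.Zmodule_isLmodule.Build R P pscaleA pscale1 pscaleDr pscaleDl.

Lemma prod_topology_cvg (F : set_system P) (x : P) : Filter F ->
  (forall a, (fun f : P => f a) @ F --> x a) -> F --> x.
Proof.
move=> FF Fx; apply/cvg_sup => a V [B [[W oW <-] Wx] BV].
by apply: filterS BV _; apply: Fx; exact: open_nbhs_nbhs.
Qed.

Lemma prod_topology_eval_continuous a : continuous (fun f : P => f a).
Proof. exact: (@proj_continuous {classic A} E a). Qed.

Let add_cont : continuous (fun x : P * P => x.1 + x.2).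
Proof.
move=> x; apply: prod_topology_cvg => a.
apply: (@continuous_comp _ _ _ (fun x : P * P => (x.1 a, x.2 a))
  (fun y : E a * E a => y.1 + y.2)); last exact: add_continuous.
apply: cvg_pair.
  apply: (@continuous_comp _ _ _ fst (fun f : P => f a)); first exact: cvg_fst.
  exact: prod_topology_eval_continuous.
apply: (@continuous_comp _ _ _ snd (fun f : P => f a)); first exact: cvg_snd.
exact: prod_topology_eval_continuous.
Qed.

Let scale_cont : continuous (fun z : R^o * P => z.1 *: z.2).
Proof.
move=> x; apply: prod_topology_cvg => a.
apply: (@continuous_comp _ _ _ (fun x : R^o * P => (x.1, x.2 a))
  (fun y : R^o * E a => y.1 *: y.2)); last exact: scale_continuous.
apply: (@cvg_pair _ _ _ _ (nbhs (x.1 : R^o))); first exact: cvg_fst.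
apply: (@continuous_comp _ _ _ snd (fun f : P => f a)); first exact: cvg_snd.
exact: prod_topology_eval_continuous.
Qed.

Let loc_convex : exists2 B : set_system P,
  (forall b, b \in B -> convex_set b) & basis B.
Proof.
pose B : set_system P := [set U | open U /\ convex_set U].
exists B; first by move=> b /set_mem[].
split=> [b []//|x].
have FF : Filter (filter_from [set U | B U /\ U x] id).
  apply: filter_from_filter.
    by exists setT; split=> //; split; [exact: openT|move=> y z l _ _; exact/mem_set].
  move=> U V [[oU cU] Ux] [[oV cV] Vx]; exists (U `&` V) => //; split=> //.
  split; first exact: openI.
  move=> y z l /set_mem[Uy Vy] /set_mem[Uz Vz]; apply/mem_set; split.
    by apply/set_mem/cU; exact/mem_set.
  by apply/set_mem/cV; exact/mem_set.
apply: prod_topology_cvg => a W Wx.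
have [C Cc [Co /(_ (x a) W Wx)[V [CV Vx] VW]]] := @locally_convex R (E a).
exists ((fun f : P => f a) @^-1` V); last by move=> y /VW.
split=> //; split.
  apply: open_comp; last exact: Co.
  by move=> y _; exact: prod_topology_eval_continuous.
move=> y z l /set_mem Vy /set_mem Vz; apply/mem_set.
by apply/set_mem/(Cc V); [exact/mem_set|exact/mem_set|exact/mem_set].
Qed.

HB.instance Definition _ :=
  PreTopologicalNmodule_isTopologicalNmodule.Build P add_cont.
HB.instance Definition _ :=
  TopologicalNmodule_isTopologicalLmodule.Build R P scale_cont.
HB.instance Definition _ := Uniform_isTvs.Build R P loc_convex.

End prod_topology_tvs.

Section sigma_product.
Context (R : realType) (A : Type) (E : A -> tvsType R).
Local Notation P := (prod_topology E).

Definition sigma_set : set P := [set x | countable [set a | x a != 0]].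

Definition sigma_product : Type := set_type sigma_set.

HB.instance Definition _ := SubType.on sigma_product.
HB.instance Definition _ := Uniform.on sigma_product.

Let sigma_submod : submod_closed (mem sigma_set).
Proof.
split=> [|k x y /set_mem cx /set_mem cy]; apply/mem_set.
  rewrite /sigma_set/= (_ : [set _ | _] = set0) ?countable0//.
  by rewrite -subset0 => a /=; rewrite eqxx.
apply: (@sub_countable _ _ _ ([set a | x a != 0] `|` [set a | y a != 0])).
  apply: subset_card_le => a /= kxya.
  have [xa|xa] := eqVneq (x a) 0; [right|by left].
  by apply: contra_neq kxya => ya; rewrite -[LHS]/(k *: x a + y a) xa ya scaler0 addr0.
by rewrite -bigcup2E; apply: bigcup_countable => // -[|[|n]] _ /=.
Qed.

HB.instance Definition _ :=
  GRing.SubChoice_isSubLmodule.Build R P (mem sigma_set) sigma_product sigma_submod.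

Local Notation Y := sigma_product.

Let val_cont : continuous (val : Y -> P).
Proof. exact: initial_continuous. Qed.

Let add_cont : continuous (fun x : Y * Y => x.1 + x.2).
Proof.
apply: (@continuous_comp_initial Y (Y * Y)%type P val) => x.
apply: (@continuous_comp _ _ _ (fun x : Y * Y => (val x.1, val x.2))
  (fun y : P * P => y.1 + y.2)); last exact: add_continuous.
apply: (@cvg_pair _ _ _ _ (nbhs (val x.1)) (nbhs (val x.2))).
  by apply: (@continuous_comp _ Y P fst val); [exact: cvg_fst|exact: val_cont].
by apply: (@continuous_comp _ Y P snd val); [exact: cvg_snd|exact: val_cont].
Qed.

Let scale_cont : continuous (fun z : R^o * Y => z.1 *: z.2).
Proof.
apply: (@continuous_comp_initial Y (R^o * Y)%type P val) => x.
apply: (@continuous_comp _ _ _ (fun x : R^o * Y => (x.1, val x.2))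
  (fun y : R^o * P => y.1 *: y.2)); last exact: scale_continuous.
apply: (@cvg_pair _ _ _ _ (nbhs (x.1 : R^o)) (nbhs (val x.2))); first exact: cvg_fst.
by apply: (@continuous_comp _ Y P snd val); [exact: cvg_snd|exact: val_cont].
Qed.

Let loc_convex : exists2 B : set_system Y,
  (forall b, b \in B -> convex_set b) & basis B.
Proof.
have [C Cc [Co Cn]] := @locally_convex R P.
exists [set val @^-1` U | U in C].
  move=> _ /set_mem[U CU <-] y z l /set_mem Uy /set_mem Uz; apply/mem_set.
  by apply/set_mem/(Cc U); [exact/mem_set|exact/mem_set|exact/mem_set].
split; first by move=> _ [U CU <-]; exists U => //; exact: Co.
move=> x V [_ [[W oW <-] Wx] WV].
have [U [CU Ux] UW] := Cn (val x) W (open_nbhs_nbhs (conj oW Wx)).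
exists (val @^-1` U); last by move=> y /UW/WV.
by split=> //; exists U.
Qed.

HB.instance Definition _ :=
  PreTopologicalNmodule_isTopologicalNmodule.Build Y add_cont.
HB.instance Definition _ :=
  TopologicalNmodule_isTopologicalLmodule.Build R Y scale_cont.
HB.instance Definition _ := Uniform_isTvs.Build R Y loc_convex.

End sigma_product.

(* Main.v *)
Require Import Defs.
From HB Require Import structures.
From mathcomp Require Import all_boot all_order all_algebra.
From mathcomp Require Import all_classical all_reals all_analysis.
From mathcomp Require Import borel_hierarchy ring lra.

(* Near a point of D the convex function f is bounded above on a set depending
   on E and on finitely many coordinates only; a convex function bounded above
   on a line is constant on it, so near that point f factors through
   E x E_a1 x ... x E_an. This product is separable, and Baire because the
   factors E_ai are completely metrizable and separable. On a separable Baire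
   space Mazur's argument applies: for each h in a countable dense set, and
   each k, the points where some second difference quotient of f in the
   direction h is less than 1/k form a dense open set, and where all these
   conditions hold the directional derivative is linear. The local dense
   G_delta sets obtained in this way are glued along a maximal disjoint family
   of open sets. *)

Set Implicit Arguments.
Unset Strict Implicit.
Unset Printing Implicit Defensive.

Import Order.TTheory GRing.Theory Num.Theory.
Import numFieldNormedType.Exports.

Local Open Scope classical_set_scope.
Local Open Scope ring_scope.

(** * Baire category: complete metrics, countable pi-bases and products *)

Lemma countable_sub_range (T : Type) (S : set T) :
  countable S -> S !=set0 -> exists u : nat -> T, S `<=` range u.
Proof.
move=> /pfcard_geP[->|[u]] [y Sy] //; exists u => x Sx.
by have [n _ <-] := 'surj_u Sx; exists n.
Qed.

(** Baire's theorem by nested closed balls, run directly on the metric [d]. The radii are at most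
    [1/(n+1)], so the centres form a Cauchy sequence, and their limit lies in every ball. *)
Lemma completely_metrizable_baire (R : realType) (T : topologicalType) :
  completely_metrizable R T -> baire_space T.
Proof.
case=> d [d0 dC dT dN dc] U oU O [x0 Ox0] oO.
have dxx x : d x x = 0 by apply/d0.
have bn x (e : R) : 0 < e -> nbhs x [set y | d x y < e].
  by move=> e0; apply/dN; exists e.
(* A state is a step index with a centre and a radius. Guarding the conclusion by a positive radius
   makes the relation total, as [choice] requires. *)
have step (p : nat * (T * R)) : exists q : T * R, 0 < p.2.2 ->
    [/\ 0 < q.2, q.2 <= p.1.+1%:R^-1 &
        [set y | d q.1 y <= q.2] `<=` U p.1 `&` [set y | d p.2.1 y < p.2.2]].
  have [r0|] := ltP 0 p.2.2; last by exists p.2.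
  have [oUn dUn] := oU p.1.
  have := bn p.2.1 _ r0; rewrite nbhsE => -[B [oB Bx] Bsub].
  have [x [Bx' Ux']] := dUn B (ex_intro _ _ Bx) oB.
  have : nbhs x (B `&` U p.1) by apply: open_nbhs_nbhs; split=> //; exact: openI.
  move/dN => [e e0 esub].
  (* Halving [e] puts the closed ball inside the open ball of radius [e]. *)
  exists (x, Num.min (e / 2) p.1.+1%:R^-1) => _ /=; split.
  - by rewrite lt_min divr_gt0//= invr_gt0 ltr0n.
  - by rewrite ge_min lexx orbT.
  - move=> y /=; rewrite le_min => /andP[ye _].
    have /esub[By Uy] : [set y | d x y < e] y by rewrite /=; lra.
    by split=> //; exact: Bsub.
have [F HF] := choice step.
have [r0 r00 r0O] := (dN x0 O).1 (open_nbhs_nbhs (conj oO Ox0)).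
pose u := fix u n := if n is n'.+1 then F (n', u n') else (x0, r0).
have u0 n : 0 < (u n).2 by elim: n => // n IH /=; have [] := HF (n, u n) IH.
have uS n : (u n.+1).2 <= n.+1%:R^-1 by have [] := HF (n, u n) (u0 n).
have uC n : [set y | d (u n.+1).1 y <= (u n.+1).2] `<=`
    U n `&` [set y | d (u n).1 y < (u n).2].
  by have [] := HF (n, u n) (u0 n).
have uN n m : (n <= m)%N ->
    [set y | d (u m).1 y <= (u m).2] `<=` [set y | d (u n).1 y <= (u n).2].
  move/subnK => <-; elim: (m - n)%N => // k IH y /uC[_ /ltW]; exact: IH.
have uD n m : (n <= m)%N -> d (u n).1 (u m).1 <= (u n).2.
  by move=> nm; apply: (uN _ _ nm) => /=; rewrite dxx ltW.
have [|x ux] := dc (fun n => (u n).1).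
  move=> e e0; have e2 : 0 < e / 2 by rewrite divr_gt0.
  have [N _ /(_ N (leqnn _))/= HN] := near_infty_natSinv_lt (PosNum e2).
  exists N.+1 => m n Nm Nn.
  have := uD _ _ Nm; have := uD _ _ Nn; have := le_lt_trans (uS N) HN.
  have := dT (u m).1 (u N.+1).1 (u n).1; rewrite [d (u m).1 (u N.+1).1]dC.
  move: (u N.+1) => v; lra.
have xC n : d (u n).1 x <= (u n).2.
  rewrite leNgt; apply/negP => lt; have e0 : 0 < d (u n).1 x - (u n).2 by lra.
  have [N _ HN] := ux _ (bn x _ e0).
  have /= := HN (maxn n N) (leq_maxr _ _).
  have := uD _ _ (leq_maxl n N); have := dT (u n).1 (u (maxn n N)).1 x.
  by rewrite [d x (u _).1]dC; lra.
exists x; split; first by apply: r0O; have [] := uC 0 x (xC 1).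
by move=> n _; have [] := uC n x (xC n.+1).
Qed.

(** The sets are the interiors of the balls of radius [1/(m+1)] about a dense sequence; codes that
    decode to no pair get the whole space. Such a pi-base suffices to test the density of slices in
    [baire_prod]. *)
Lemma countable_pi_base (R : realType) (T : topologicalType) :
  completely_metrizable R T -> separable_space T -> [set: T] !=set0 ->
  exists B : nat -> set T, (forall n, open (B n) /\ B n !=set0) /\
    forall O, open O -> O !=set0 -> exists n, B n `<=` O.
Proof.
case=> d [d0 dC dT dN _] [S cS dS] T0.
have [|u Su] := countable_sub_range cS.
  by have [z []] := dS _ T0 openT; exists z.
have dxx x : d x x = 0 by apply/d0.
have bn x (e : R) : 0 < e -> nbhs x [set y | d x y < e].
  by move=> e0; apply/dN; exists e.
pose b (p : nat * nat) := ([set y | d (u p.1) y < p.2.+1%:R^-1]^°)%classic.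
have bb n m : b (n, m) (u n) by apply: bn; rewrite invr_gt0 ltr0n.
exists (fun k => if unpickle k is Some p then b p else setT); split.
  move=> k; case: unpickle => [[n m]|]; last by split=> //; exact: openT.
  by split; [exact: open_interior|exists (u n)].
move=> O oO [x Ox].
have [e e0 eO] := (dN x O).1 (open_nbhs_nbhs (conj oO Ox)).
have e2 : 0 < e / 2 by rewrite divr_gt0.
have [m _ /(_ m (leqnn _)) /= Hm] := near_infty_natSinv_lt (PosNum e2).
pose V := ([set y | d x y < m.+1%:R^-1]^°)%classic.
have Vx : V x by apply: bn; rewrite invr_gt0 ltr0n.
have [z [/interior_subset /= xz /Su[n _ nz]]] :=
  dS V (ex_intro _ x Vx) (open_interior _).
rewrite -nz in xz; have xn := lt_trans xz Hm.
exists (pickle (n, m)); rewrite pickleK => y /interior_subset /= ny0.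
have ny := lt_trans ny0 Hm.
by apply: eO => /=; have := dT x (u n) y; lra.
Qed.

(* The easy half of the Kuratowski-Ulam theorem: for generic z, all slices at z
   of countably many dense open sets are dense. *)
Lemma baire_prod (R : realType) (Z M : topologicalType) :
  baire_space Z -> completely_metrizable R M -> separable_space M ->
  baire_space (Z * M)%type.
Proof.
move=> bZ cM sM U oU O [[z0 y0] Ozy] oO.
have [B [oB Bsub]] := countable_pi_base cM sM (ex_intro _ y0 I).
have [[Q1 Q2]/= [nQ1 nQ2] Q12] : nbhs (z0, y0) O by apply: open_nbhs_nbhs.
move: nQ1 nQ2; rewrite !nbhsE => -[V1 [oV1 V1z] V1Q] [V2 [oV2 V2y] V2Q].
(* [P n m] is the projection to [Z] of the part of [U n] over [B m]. If [z] lies in all of them,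
   every slice of [U n] at [z] meets every [B m], hence is dense in [M]. *)
pose P (n m : nat) := [set z | exists2 y, B m y & U n (z, y)].
have oP n m : open (P n m).
  rewrite openE => z [y By Uzy]; have [oUn _] := oU n.
  have [[W1 W2]/= [W1z W2y] W12] : nbhs (z, y) (U n) by apply: open_nbhs_nbhs.
  by apply: filterS W1z => z' W1z'; exists y => //; apply: W12; split=> //=;
    exact: nbhs_singleton.
have dP n m : dense (P n m).
  move=> W [z Wz] oW; have [oBm [y By]] := oB m.
  have [_ dUn] := oU n.
  have [||[z' y'] [[Wz' By'] Uzy']] := dUn (W `*` B m).
  - by exists (z, y).
  - rewrite openE => -[z' y'] /= [Wz' By'].
    by exists (W, B m) => //; split; exact: open_nbhs_nbhs.
  - by exists z'; split=> //; exists y'.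
have [|z [V1z' Pz]] :=
    bZ (fun k => if unpickle k is Some p then P p.1 p.2 else setT) _ V1
    (ex_intro _ _ V1z) oV1.
  move=> k; case: unpickle => [[n m]|]; first by split; [exact: oP|exact: dP].
  by split; [exact: openT|move=> W [w Ww] _; exists w].
have [|y [V2y' Uy]] :=
    completely_metrizable_baire cM (U := fun n => [set y | U n (z, y)]) _
    (ex_intro _ _ V2y) oV2.
  move=> n; have [oUn _] := oU n; split.
    rewrite openE => y Uzy.
    have [[W1 W2]/= [W1z W2y] W12] : nbhs (z, y) (U n) by apply: open_nbhs_nbhs.
    by apply: filterS W2y => y' W2y'; apply: W12; split=> //=;
      exact: nbhs_singleton.
  move=> W [w Ww] oW; have [m BW] := Bsub _ oW (ex_intro _ w Ww).
  have := Pz (pickle (n, m)) I; rewrite pickleK => -[y By Uzy].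
  by exists y; split=> //; exact: BW.
by exists (z, y); split; [apply: Q12; split; [exact: V1Q|exact: V2Q]|].
Qed.

Lemma separable_prod (T1 T2 : topologicalType) :
  separable_space T1 -> separable_space T2 -> separable_space (T1 * T2)%type.
Proof.
move=> [S1 cS1 dS1] [S2 cS2 dS2]; exists (S1 `*` S2); first exact: countableX.
move=> O [[x y] Oxy] oO.
have [[Q1 Q2]/= [nQ1 nQ2] Q12] : nbhs (x, y) O by apply: open_nbhs_nbhs.
move: nQ1 nQ2; rewrite !nbhsE => -[V1 [oV1 V1x] V1Q] [V2 [oV2 V2y] V2Q].
have [x' [Vx' Sx']] := dS1 _ (ex_intro _ _ V1x) oV1.
have [y' [Vy' Sy']] := dS2 _ (ex_intro _ _ V2y) oV2.
by exists (x', y'); split=> //; apply: Q12; split; [exact: V1Q|exact: V2Q].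
Qed.

(** * Convexity, lines and second differences *)

Lemma linear_wrap (R : realType) (U V : lmodType R) (f : U -> V) :
  linear f -> exists L : {linear U -> V}, forall x, L x = f x.
Proof.
move=> lf; pose fM := GRing.isLinear.Build R U V *:%R f lf.
by pose L : {linear U -> V} := HB.pack f fM; exists L.
Qed.

Lemma convex_setE (R : realType) (M : lmodType R) (W : set M) (x y : M) (t : R) :
  convex_set W -> 0 <= t -> t <= 1 -> W x -> W y -> W (t *: x + (1 - t) *: y).
Proof.
move=> cW t0 t1 Wx Wy.
by have /set_mem := cW x y (Itv01 t0 t1) (mem_set Wx) (mem_set Wy).
Qed.

Lemma convex_functionE (R : realType) (M : lmodType R) (W : set M) (g : M -> R)
    (x y : M) (t : R) :
  convex_function W g -> 0 <= t -> t <= 1 -> W x -> W y ->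
  g (t *: x + (1 - t) *: y) <= t * g x + (1 - t) * g y.
Proof.
move=> cg t0 t1 Wx Wy.
exact: (cg (Itv01 t0 t1) x y (mem_set Wx) (mem_set Wy)).
Qed.

Lemma convex_functionP (R : realType) (M : lmodType R) (W : set M) (g : M -> R) :
  (forall x y (t : R), 0 <= t -> t <= 1 -> W x -> W y ->
    g (t *: x + (1 - t) *: y) <= t * g x + (1 - t) * g y) ->
  convex_function W g.
Proof. by move=> cg t x y /set_mem Wx /set_mem Wy; exact: (cg x y t%:num). Qed.

Lemma line_continuous (R : realType) (Z : tvsType R) (x h : Z) :
  continuous (fun t : R^o => x + t *: h).
Proof.
move=> t; apply: (@continuous_comp _ _ _ (fun t : R^o => (x, t *: h))
  (fun z : Z * Z => z.1 + z.2)); last exact: add_continuous.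
apply: cvg_pair; first exact: cvg_cst.
apply: (@continuous_comp _ _ _ (fun t : R^o => (t, h))
  (fun z : R^o * Z => z.1 *: z.2)); last exact: scale_continuous.
by apply: (@cvg_pair _ _ _ _ (nbhs (t : R^o))); [exact: cvg_id|exact: cvg_cst].
Qed.

Lemma translate_continuous (R : realType) (Z : tvsType R) (x : Z) :
  continuous (fun y : Z => y + x).
Proof.
move=> y; apply: (@continuous_comp _ _ _ (fun y : Z => (y, x))
  (fun z : Z * Z => z.1 + z.2)); last exact: add_continuous.
by apply: cvg_pair; [exact: cvg_id|exact: cvg_cst].
Qed.

Lemma nbhs_line (R : realType) (Z : tvsType R) (x h : Z) (W : set Z) :
  nbhs x W -> exists2 e : R, 0 < e & forall t, `|t| < e -> W (x + t *: h).
Proof.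
move=> Wx; have : nbhs (0 : R^o) [set t | W (x + t *: h)].
  by apply: line_continuous; rewrite scale0r addr0.
move=> /nbhs_ballP[e e0 eW]; exists e => // t te; apply: eW.
by rewrite -ball_normE /= sub0r normrN.
Qed.

(* The second difference q(s, t) satisfies q(s, 2t) = q(s-t, t) + 2 q(s, t) +
   q(s+t, t), so that a lower bound c * t for q on the triangle |s| + t < d
   improves to 2c * t. *)
Lemma small_second_difference (R : realType) (phi : R -> R) (d c : R) :
  0 < d -> 0 < c -> exists s t : R,
    [/\ 0 < t, `|s| + t < d & phi (s + t) + phi (s - t) - 2 * phi s < c * t].
Proof.
move=> d0 c0; apply: contrapT => H.
have P n s t : 0 < t -> `|s| + t < d ->
    2 ^+ n * c * t <= phi (s + t) + phi (s - t) - 2 * phi s.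
  elim: n s t => [|n IH] s t t0 st.
    rewrite expr0 mul1r leNgt; apply/negP => lt; apply: H; by exists s, t.
  have t20 : 0 < t / 2 by rewrite divr_gt0.
  have := IH s (t / 2) t20; have := IH (s + t / 2) (t / 2) t20.
  have := IH (s - t / 2) (t / 2) t20.
  have n1 := ler_normB s (t / 2); have n2 := ler_normD s (t / 2).
  rewrite (gtr0_norm t20) in n1 n2.
  have -> : s - t / 2 + t / 2 = s by ring.
  have -> : s + t / 2 - t / 2 = s by ring.
  have -> : s + t / 2 + t / 2 = s + t by field.
  have -> : s - t / 2 - t / 2 = s - t by field.
  (* The weights 1, 2, 1 add up to 4 while the step is halved: a net gain of a factor 2. *)
  have e : 2 ^+ n.+1 * c * t = 4 * (2 ^+ n * c * (t / 2)) by rewrite exprS; field.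
  rewrite e; move: (2 ^+ n * c * (t / 2)) => k.
  by move=> /(_ ltac:(lra)) ? /(_ ltac:(lra)) ? /(_ ltac:(lra)) ?; lra.
(* The point [(0, d / 2)] lies in the triangle, so [P] would bound the fixed number [q] below by
   [2 ^+ n * (c * (d / 2))] for every [n]. *)
pose q := phi (0 + d / 2) + phi (0 - d / 2) - 2 * phi 0.
have cd : 0 < c * (d / 2) by rewrite mulr_gt0// divr_gt0.
have [n] : exists n, q < 2 ^+ n * (c * (d / 2)).
  have := Num.Theory.archi_boundP (normr_ge0 (q / (c * (d / 2)))).
  set n := Num.bound _ => Hn; exists n; rewrite -ltr_pdivrMr//.
  apply: le_lt_trans (ler_norm _) _; apply: lt_le_trans Hn _.
  by rewrite -natrX ler_nat ltnW// ltn_expl.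
apply/negP; rewrite -leNgt mulrA; apply: P; rewrite ?divr_gt0//.
by rewrite normr0 add0r; lra.
Qed.

(** * One-sided directional derivatives of a convex function *)

Section directional_derivative.
Context (R : realType) (Z : tvsType R) (W : set Z) (g : Z -> R) (x : Z).
Hypotheses (oW : open W) (cW : convex_set W) (cg : convex_function W g).
Hypothesis Wx : W x.

Let q (h : Z) (t : R) := (g (x + t *: h) - g x) / t.
Let dom (h : Z) := [set t : R | 0 < t /\ W (x + t *: h)].

Let nW : nbhs x W.
Proof. exact: open_nbhs_nbhs. Qed.

Let cvx (y z : Z) (t : R) : 0 <= t -> t <= 1 -> W y -> W z ->
  W (t *: y + (1 - t) *: z) /\
  g (t *: y + (1 - t) *: z) <= t * g y + (1 - t) * g z.
Proof.
move=> t0 t1 Wy Wz; split; first exact: convex_setE.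
exact: convex_functionE cg _ _ _ _.
Qed.

Let dom_small h : exists2 e : R, 0 < e & forall t, 0 < t -> t < e -> dom h t.
Proof.
have [e e0 He] := nbhs_line h nW; exists e => // t t0 te; split=> //.
by apply: He; rewrite gtr0_norm.
Qed.

Let q_mono h s t : 0 < s -> s <= t -> W (x + t *: h) -> q h s <= q h t.
Proof.
move=> s0 st Wt; have t0 : 0 < t by lra.
have [||_] := @cvx (x + t *: h) x (s / t) _ _ Wt Wx.
- by rewrite divr_ge0 // ltW.
- by rewrite ler_pdivrMr// mul1r.
have -> : (s / t) *: (x + t *: h) + (1 - s / t) *: x = x + s *: h.
  rewrite scalerDr addrAC -scalerDl scalerA divfK ?gt_eqF//.
  by rewrite [_ + (1 - _)]addrC subrK scale1r.
move=> H; rewrite /q ler_pdivrMr// mulrAC ler_pdivlMr//.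
have : (g (x + s *: h) - g x) * t <= (s / t * (g (x + t *: h) - g x)) * t.
  by rewrite ler_pM2r//; lra.
by rewrite mulrAC divfK ?gt_eqF// [s * _]mulrC.
Qed.

(** The point [x] divides the segment from [x - s h] to [x + t h] with weights [t / (s + t)] and
    [s / (s + t)]. This bounds the quotients below, so that their infimum is meaningful. *)
Let q_lower h s t : dom (- h) s -> dom h t -> - q (- h) s <= q h t.
Proof.
move=> [s0 Ws] [t0 Wt]; have st0 : 0 < s + t by lra.
have st1 : 1 - t / (s + t) = s / (s + t).
  by rewrite -[1 in LHS](@divff _ (s + t)) ?gt_eqF// -mulrBl addrK.
have [||_] := @cvx (x + s *: - h) (x + t *: h) (t / (s + t)) _ _ Ws Wt.
- by rewrite divr_ge0// ltW.
- by rewrite ler_pdivrMr// mul1r; lra.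
rewrite st1.
have -> : (t / (s + t)) *: (x + s *: - h) + (s / (s + t)) *: (x + t *: h) = x.
  rewrite !scalerDr addrACA -scalerDl -mulrDl [t + s]addrC divff ?gt_eqF//.
  rewrite scale1r !scalerA scalerN mulrAC [s / _ * _]mulrAC [t * s]mulrC.
  by rewrite addNr addr0.
rewrite /q; move: (g (x + s *: - h)) (g (x + t *: h)) (g x) => a b c H.
have {H} H : (s + t) * c <= t * a + s * b.
  have e : t * a + s * b = (s + t) * (t / (s + t) * a + s / (s + t) * b).
    by field; rewrite gt_eqF.
  by rewrite e ler_pM2l //.
rewrite -mulNr ler_pdivrMr// mulrAC ler_pdivlMr//; lra.
Qed.

Let q_lb h : has_lbound (q h @` dom h).
Proof.
have [e e0 He] := dom_small (- h); exists (- q (- h) (e / 2)) => _ [t dt <-].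
by apply: q_lower => //; apply: He; lra.
Qed.

(** The right derivative of [g] at [x] along [h]: the quotients are monotone in [t], so their limit
    at 0 is an infimum. *)
Definition dird (h : Z) : R := inf (q h @` dom h).

Lemma dird_le h t : 0 < t -> W (x + t *: h) -> dird h <= (g (x + t *: h) - g x) / t.
Proof. by move=> t0 Wt; apply: ge_inf => //; exists t. Qed.

Let dird_ge h c : (forall t, dom h t -> c <= q h t) -> c <= dird h.
Proof.
move=> H; apply: lb_le_inf; last by move=> _ [t dt <-]; exact: H.
have [e e0 He] := dom_small h; exists (q h (e / 2)), (e / 2) => //.
by apply: He; lra.
Qed.

Lemma dird_near h e : 0 < e -> exists2 d : R, 0 < d &
  forall t, 0 < t -> t < d ->
    W (x + t *: h) /\ (g (x + t *: h) - g x) / t < dird h + e.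
Proof.
move=> e0; have [|_ [t0 [t00 Wt0] <-] lt] := @inf_adherent _ (q h @` dom h) e e0.
  split=> //; have [d d0 Hd] := dom_small h; exists (q h (d / 2)), (d / 2) => //.
  by apply: Hd; lra.
have [d d0 Hd] := dom_small h; exists (Num.min d t0); first by rewrite lt_min d0.
move=> t t1; rewrite lt_min => /andP[td tt0]; split; first by have [] := Hd t t1 td.
by apply: le_lt_trans lt; apply: q_mono => //; exact: ltW.
Qed.

Lemma dird0 : dird 0 = 0.
Proof.
apply/eqP; rewrite eq_le; apply/andP; split.
  by have := @dird_le 0 1 ltr01; rewrite scaler0 addr0 subrr mul0r; exact.
by apply: dird_ge => t _; rewrite /q scaler0 addr0 subrr mul0r.
Qed.

(** Convexity at the midpoint of [x + t h] and [x + t k], which is [x + (t / 2) (h + k)], for [t]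
    small enough for both directions. *)
Lemma dirdD h k : dird (h + k) <= dird h + dird k.
Proof.
apply/ler_addgt0Pr => e e0; have e2 : 0 < e / 2 by rewrite divr_gt0.
have [d1 d10 H1] := dird_near h e2; have [d2 d20 H2] := dird_near k e2.
pose t := Num.min d1 d2 / 2.
have m0 : 0 < Num.min d1 d2 by rewrite lt_min d10.
have t0 : 0 < t by rewrite divr_gt0.
have tm : t < Num.min d1 d2 by rewrite /t; lra.
have [td1 td2] : t < d1 /\ t < d2 by move: tm; rewrite lt_min => /andP[].
have [W1 q1] := H1 t t0 td1; have [W2 q2] := H2 t t0 td2.
have [||W3] := @cvx (x + t *: h) (x + t *: k) (1 / 2) _ _ W1 W2; [lra|lra|].
have E : (1 / 2) *: (x + t *: h) + (1 - 1 / 2) *: (x + t *: k) =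
    x + (t / 2) *: (h + k).
  rewrite !scalerDr !scalerA addrACA -scalerDl [_ + (1 - _)]addrC subrK scale1r.
  by congr (_ + (_ *: _ + _ *: _)); field.
rewrite E in W3 *; move=> H3.
have t20 : 0 < t / 2 by rewrite divr_gt0.
have := dird_le t20 W3; move: H3 q1 q2.
move: (g (x + (t / 2) *: _)) (g (x + t *: h)) (g (x + t *: k)) (g x) => a b c z.
move=> H3 q1 q2.
have : (a - z) / (t / 2) <= (b - z) / t + (c - z) / t.
  rewrite -mulrDl ler_pdivrMr//.
  have -> : (b - z + (c - z)) / t * (t / 2) = (b - z + (c - z)) / 2.
    by field; rewrite gt_eqF.
  lra.
lra.
Qed.

Lemma dirdZ c h : 0 < c -> dird (c *: h) = c * dird h.
Proof.
have le b k : 0 < b -> dird (b *: k) <= b * dird k.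
  move=> b0; rewrite mulrC -ler_pdivrMr//; apply: dird_ge => t [t0 Wt].
  rewrite ler_pdivrMr//.
  have E : (t / b) *: (b *: k) = t *: k by rewrite scalerA divfK ?gt_eqF.
  have := @dird_le (b *: k) (t / b) (divr_gt0 t0 b0).
  by rewrite E invf_div mulrA => /(_ Wt); rewrite mulrAC.
move=> c0; apply/eqP; rewrite eq_le le//=.
rewrite -ler_pdivlMl//; have := le c^-1 (c *: h).
by rewrite invr_gt0 scalerA mulVf ?gt_eqF// scale1r; exact.
Qed.

Hypothesis gx : {for x, continuous g}.
(** In these directions [dird h + dird (- h)] is at most 0, being bounded by every second difference
    quotient. *)
Hypothesis dense_smooth : dense [set h | forall e : R, 0 < e ->
  exists t : R, [/\ 0 < t, W (x + t *: h), W (x - t *: h) &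
    g (x + t *: h) + g (x - t *: h) - 2 * g x < e * t]].

(** The quotient at [t = 1] gives [dird h <= g (x + h) - g x], which continuity of [g] at [x] makes
    small. *)
Let dird_small e : 0 < e -> nbhs 0 [set h | dird h < e /\ dird (- h) < e].
Proof.
move=> e0.
have H : nbhs 0 [set h | dird h < e].
  have nx : nbhs x [set y | W y /\ g y < g x + e].
    apply: filterI => //.
    have lt : g x < g x + e by lra.
    exact: (@cvgr_lt _ _ _ _ g (g x) gx _ lt).
  have : nbhs 0 [set h | W (h + x) /\ g (h + x) < g x + e].
    apply: (@translate_continuous R Z x 0 [set y | W y /\ g y < g x + e]).
    by rewrite add0r.
  apply: filterS => h [+ +]; rewrite addrC => Wh gh /=.
  have := @dird_le h 1 ltr01; rewrite scale1r divr1 => /(_ Wh) /le_lt_trans -> //.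
  by rewrite ltrBlDl.
apply: filterI => //.
have : nbhs (- 0 : Z) [set h | dird h < e] by rewrite oppr0.
exact: (@opp_continuous Z 0 [set h | dird h < e]).
Qed.

(** Subadditivity gives one inequality. For the other, [h] is replaced by a nearby [k] of the dense
    set; [dird (h - k)], [dird (k - h)] and [dird k + dird (- k)] each cost less than [e / 4]. *)
Let dirdN h : dird (- h) = - dird h.
Proof.
suff : dird h + dird (- h) <= 0.
  have := dirdD h (- h); rewrite subrr dird0 => ? ?; lra.
apply/ler_addgt0Pr => e e0; have e4 : 0 < e / 4 by rewrite divr_gt0.
have : nbhs h [set k | dird (k - h) < e / 4 /\ dird (- (k - h)) < e / 4].
  apply: (@translate_continuous R Z (- h) h
    [set k | dird k < e / 4 /\ dird (- k) < e / 4]).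
  by rewrite subrr; exact: dird_small.
rewrite nbhsE => -[V [oV Vh] Vsub].
have [k [/Vsub [k1 k2] /(_ _ e4)[t [t0 W1 W2 kt]]]] :=
  dense_smooth (ex_intro _ h Vh) oV.
have := dirdD k (h - k); have := dirdD (- k) (k - h).
rewrite [k + (h - k)]addrC subrK addrA addNr add0r.
rewrite opprB in k2.
have := dird_le t0 W1; have := @dird_le (- k) t t0.
rewrite scalerN => /(_ W2) a b c d; rewrite /= in k1.
have : (g (x + t *: k) - g x) / t + (g (x - t *: k) - g x) / t < e / 4.
  by rewrite -mulrDl ltr_pdivrMr//; lra.
lra.
Qed.

Lemma gateaux_differentiable_dense : gateaux_differentiable W g x.
Proof.
have dD h k : dird (h + k) = dird h + dird k.
  have := dirdD (- h) (- k); rewrite -opprD !dirdN; have := dirdD h k => ? ?; lra.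
have dZ c h : dird (c *: h) = c * dird h.
  have [c0|c0|->] := ltgtP c 0; last by rewrite scale0r mul0r dird0.
    by rewrite -[c]opprK [RHS]mulNr scaleNr dirdN dirdZ// oppr_gt0.
  exact: dirdZ.
have [|L HL] := @linear_wrap R Z R^o dird; first by move=> c h k; rewrite dD dZ.
exists L.
  move=> h; apply/cvgrPdist_lt => e e0.
  have : nbhs h [set k | dird (k - h) < e /\ dird (- (k - h)) < e].
    apply: (@translate_continuous R Z (- h) h
      [set k | dird k < e /\ dird (- k) < e]).
    by rewrite subrr; exact: dird_small.
  apply: filterS => k /= [k1 k2].
  by rewrite !HL distrC -dirdN -dD ltr_norml k1 andbT; move: k2; rewrite dirdN; lra.
move=> h e e0; have [d1 d10 H1] := dird_near h e0.
have [d2 d20 H2] := dird_near (- h) e0.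
(* For positive [t] the quotient lies between [dird h] and [dird h + e]; negative [t] reduces to the
   direction [- h] and oddness of [dird]. *)
exists (Num.min d1 d2); first by rewrite lt_min d10.
move=> t; rewrite normr_gt0 HL lt_min => t0 /andP[t1 t2].
have [tn|tp|t00] := ltgtP t 0; last by rewrite t00 eqxx in t0.
  have tn' : 0 < - t by rewrite oppr_gt0.
  rewrite ltr0_norm// in t2; have [] := H2 _ tn' t2.
  rewrite scaleNr scalerN opprK => Wt b; split=> //; move: b.
  have := @dird_le (- h) _ tn'; rewrite scaleNr scalerN opprK => /(_ Wt).
  rewrite dirdN invrN mulrN => a b.
  rewrite ltr_norml; lra.
rewrite gtr0_norm// in t1; have [Wt b] := H1 _ tp t1; split=> //.
by have := dird_le tp Wt; rewrite ltr_norml; lra.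
Qed.

End directional_derivative.

(** * Generic Gâteaux differentiability: Mazur's argument and gluing *)

(** For open [U], differentiability on a dense G_delta subset of [U], encoded by open sets of [X]
    instead of the subspace topology, which eases restriction, pullback and union. *)
Definition generically_gateaux (R : realType) (X : tvsType R) (D : set X)
    (f : X -> R) (U : set X) :=
  exists O : nat -> set X, [/\ forall n, open (O n) /\ O n `<=` U,
    forall V, open V -> V !=set0 -> V `<=` U -> V `&` \bigcap_n O n !=set0 &
    forall x, (\bigcap_n O n) x -> gateaux_differentiable D f x].

Lemma mazur (R : realType) (Z : tvsType R) (W : set Z) (g : Z -> R) :
  baire_space Z -> separable_space Z -> open W -> convex_set W ->
  convex_function W g -> (forall x, W x -> {for x, continuous g}) ->
  generically_gateaux W g W.
Proof.
move=> bZ [S cS dS] oW cW cg ctg.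
have [|u Su] := countable_sub_range cS.
  by have [|z []] := dS setT _ openT; [exists 0|exists z].
pose P (n k : nat) := [set x | W x /\ exists t : R,
  [/\ 0 < t, W (x + t *: u n), W (x - t *: u n) &
    g (x + t *: u n) + g (x - t *: u n) - 2 * g x < k.+1%:R^-1 * t]].
(* A [t] that witnesses the condition at [x] still does so at all nearby points, by continuity of
   [g] on [W]. *)
have oP n k : open (P n k).
  rewrite openE => x [Wx [t [t0 W1 W2 gt]]].
  have nW y : nbhs x [set z | W (z + y)] <-> W (x + y).
    split=> [/nbhs_singleton//|Wxy].
    apply: (@translate_continuous R Z y x W).
    exact: open_nbhs_nbhs.
  have cgy y : W (x + y) -> (fun z => g (z + y)) @ x --> g (x + y).
    move=> Wxy; apply: (@continuous_comp _ _ _ (fun z => z + y) g).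
      exact: translate_continuous.
    exact: ctg.
  have H : nbhs x [set z | g (z + t *: u n) + g (z - t *: u n) - 2 * g z <
      k.+1%:R^-1 * t].
    apply: (cvgr_lt (g (x + t *: u n) + g (x - t *: u n) - 2 * g x)) => //.
    apply: cvgB; first by apply: cvgD; exact: cgy.
    by apply: cvgM; [exact: cvg_cst|exact: ctg].
  have W0 : nbhs x W by exact: open_nbhs_nbhs.
  near=> z; split; first by near: z.
  by exists t; split => //; near: z; [exact/nW|exact/nW|exact: H].
(* [small_second_difference] on the line through [x] in the direction [u n] yields a point
   [x + s u_n] of [V] and a step [t] that stays in [V]. *)
have dP n k V : open V -> V !=set0 -> V `<=` W -> V `&` P n k !=set0.
  move=> oV [x Vx] VW.
  have [d d0 Hd] := nbhs_line (u n) (open_nbhs_nbhs (conj oV Vx)).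
  have k0 : 0 < k.+1%:R^-1 :> R by rewrite invr_gt0 ltr0n.
  have [s [t [t0 st Hst]]] :=
    small_second_difference (fun t => g (x + t *: u n)) d0 k0.
  have s1 : `|s + t| < d.
    by apply: le_lt_trans st; rewrite -[t in leRHS]gtr0_norm// ler_normD.
  have s2 : `|s - t| < d.
    by apply: le_lt_trans st; rewrite -[t in leRHS]gtr0_norm// ler_normB.
  have s3 : `|s| < d by lra.
  exists (x + s *: u n); split; first exact: Hd.
  split; first by apply: VW; exact: Hd.
  exists t; rewrite -!addrA -scalerBl -scalerDl.
  by split; [|apply: VW; exact: Hd|apply: VW; exact: Hd|rewrite addrA].
exists (fun m => if unpickle m is Some p then P p.1 p.2 else W); split.
- by move=> m; case: unpickle => [[n k]|//]; split=> //= x [].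
- move=> V oV [x Vx] VW.
  (* The sets are dense only in [W], while the Baire property concerns dense sets of [Z]; adding the
     exterior [C] of [W] makes them dense in [Z], and [V] does not meet [C]. *)
  pose C := (~` closure W)%classic.
  have oC : open C by exact/closed_openC/closed_closure.
  have [|y [Vy Oy]] := bZ (fun m =>
      (if unpickle m is Some p then P p.1 p.2 else W) `|` C)
      _ V (ex_intro _ x Vx) oV.
    move=> m; split.
      by apply: openU => //; case: unpickle => [[n k]|//].
    move=> V' V'0 oV'.
    have [[y [V'y Wy]]|H] := pselect (V' `&` W !=set0).
      have [z [[V'z Wz] Pz]] : (V' `&` W) `&`
          (if unpickle m is Some p then P p.1 p.2 else W) !=set0.
        case: unpickle => [[n k]|]; last by exists y.
        apply: dP; [exact: openI|by exists y|by move=> ? []].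
      by exists z; split=> //; left.
    have [y V'y] := V'0; exists y; split=> //; right => cy.
    have [z [Wz V'z]] := cy V' (open_nbhs_nbhs (conj oV' V'y)).
    by apply: H; exists z.
  exists y; split=> // m _; have [//|Cy] := Oy m I.
  by have := Cy (subset_closure (VW _ Vy)).
move=> x Ox.
have Wx : W x.
  by have := Ox 0%N I; case: unpickle => [[n k] []|].
apply: (gateaux_differentiable_dense oW cW cg Wx (ctg x Wx)).
move=> V V0 oV; have [h [Vh /Su[n _ nh]]] := dS V V0 oV.
exists h; split=> // e e0.
have [k _ /(_ k (leqnn _)) /= Hk] := near_infty_natSinv_lt (PosNum e0).
have := Ox (pickle (n, k)) I; rewrite pickleK => -[_ [t [t0 W1 W2 gt]]].
exists t; rewrite -nh; split=> //; apply: lt_trans gt _.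
by rewrite ltr_pM2r.
Unshelve. all: by end_near. Qed.

Lemma generically_gateaux_sub (R : realType) (X : tvsType R) (D : set X)
    (f : X -> R) (U V : set X) :
  open V -> V `<=` U -> generically_gateaux D f U -> generically_gateaux D f V.
Proof.
move=> oV VU [Q [oO dO gO]]; exists (fun n => Q n `&` V); split.
- move=> n; have [oOn _] := oO n.
  by split; [exact: openI|move=> x []].
- move=> V' oV' V'0 V'V.
  have [x [V'x Ox]] := dO V' oV' V'0 (subset_trans V'V VU).
  exists x; split=> // n _; split; [exact: Ox|exact: V'V].
- by move=> x Ox; apply: gO => n _; have [] := Ox n I.
Qed.

(* As in the Banach category theorem: disjointness of the family makes the
   intersection over n commute with the union over the family. *)
Lemma generically_gateaux_global (R : realType) (X : tvsType R) (D : set X)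
    (f : X -> R) :
  open D ->
  (forall x, D x -> exists U, [/\ open U, U x, U `<=` D &
    generically_gateaux D f U]) ->
  exists G : set (set_type D), [/\ Gdelta G, dense G &
    forall x, G x -> gateaux_differentiable D f (set_val x)].
Proof.
move=> oD loc.
pose good := [set U : set X | [/\ open U, U `<=` D & generically_gateaux D f U]].
have [F [Fgood tF maxF]] := ex_maximal_disjoint_subcollection id good.
have exQ (U : set X) : exists Q : nat -> set X, good U ->
    [/\ forall n, open (Q n) /\ Q n `<=` U,
      forall V, open V -> V !=set0 -> V `<=` U -> V `&` \bigcap_n Q n !=set0 &
      forall x, (\bigcap_n Q n) x -> gateaux_differentiable D f x].
  have [[_ _ [QU HU]]|nU] := pselect (good U); first by exists QU.
  by exists (fun=> set0).
have [Q HO] := choice exQ.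
pose H n := \bigcup_(U in F) Q U n.
exists (\bigcap_n (set_val @^-1` H n)); split.
- exists (fun n => set_val @^-1` H n) => // n.
  apply: open_comp; first by move=> x _; exact: initial_continuous.
  by apply: bigcup_open => U /Fgood/HO[QU _ _]; exact: (QU n).1.
- move=> V' [y V'y] [V oV VE]; have Vy : V (set_val y) by rewrite -VE in V'y.
  rewrite -VE.
  have oVD : open (V `&` D) by exact: openI.
  have Dy : D (set_val y) by exact: set_valP.
  have [[U FU [z [[Vz Dz] Uz]]]|nF] :=
      pselect (exists2 U, F U & (V `&` D) `&` U !=set0).
    have [oU UD _] := Fgood U FU.
    have [_ dOU _] := HO U (Fgood U FU).
    have [|||w [[[Vw Dw] Uw] Ow]] := dOU ((V `&` D) `&` U).
    + exact: openI.
    + by exists z.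
    + by move=> ? [].
    exists (exist _ w (mem_set Dw)); split=> // n _.
    by exists U => //; exact: Ow.
  (* If [V] within [D] missed all of [F], its trace [U1] on a good neighbourhood could be added to
     [F], against maximality. *)
  exfalso; have [U0 [oU0 U0y U0D gU0]] := loc _ Dy.
  pose U1 := U0 `&` (V `&` D).
  have oU1 : open U1 by exact: openI.
  have U1y : U1 (set_val y) by [].
  have FU1 U : F U -> U `&` U1 = set0.
    move=> FU; rewrite -subset0 => z [Uz [_ VDz]]; apply: nF.
    by exists U => //; exists z.
  apply: (maxF (U1 |` F)).
  + split; first by move=> U FU; right.
    move=> /(_ U1 (or_introl erefl)) /FU1; rewrite setIid => U10.
    by rewrite U10 in U1y.
  + move=> U [->|/Fgood//]; split=> //; first by move=> z [_ []].
    by apply: generically_gateaux_sub gU0 => // z [].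
  + move=> U U' [->|FU] [->|FU'] //=.
    * by rewrite setIC FU1// => -[].
    * by rewrite FU1// => -[].
    * exact: tF.
- move=> x Gx; have [U FU QUx] := Gx 0%N I.
  have [oU _ gU] := HO U (Fgood U FU); apply: gU => n _.
  have [U' FU' QU'x] := Gx n I; have [oU' _ _] := HO U' (Fgood U' FU').
  suff -> : U = U' by [].
  apply: tF => //; exists (set_val x); split.
    exact: (oU 0%N).2.
  exact: (oU' n).2.
Qed.

(** * Reduction to finitely many coordinates *)

Lemma convex_function_bounded_line (R : realType) (X : lmodType R) (D : set X)
    (f : X -> R) (x v : X) (M : R) :
  convex_function D f -> (forall t : R, D (x + t *: v) /\ f (x + t *: v) <= M) ->
  f (x + v) <= f x.
Proof.
move=> cf H; rewrite leNgt; apply/negP => lt.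
have [Dx fxM] : D x /\ f x <= M by have := H 0; rewrite scale0r addr0.
pose e := f (x + v) - f x; have e0 : 0 < e by rewrite subr_gt0.
(* Convexity forces growth of slope at least [e] beyond [x + v], so at this [t] the value of [f]
   would be at least [M + e]. *)
pose t := (M - f x) / e + 1.
have t1 : 1 <= t by rewrite lerDr divr_ge0 ?subr_ge0// ltW.
have t0 : 0 < t by exact: lt_le_trans ltr01 t1.
have [Dt ft] := H t.
have := @convex_functionE R X D f (x + t *: v) x t^-1 cf.
rewrite invr_ge0 (ltW t0) invf_le1// => /(_ isT t1 Dt Dx).
have -> : t^-1 *: (x + t *: v) + (1 - t^-1) *: x = x + v.
  rewrite scalerDr addrAC -scalerDl [_ + (1 - _)]addrC subrK scale1r.
  by rewrite scalerA mulVf ?gt_eqF// scale1r.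
apply/negP; rewrite -ltNge.
have -> : f (x + v) = e + f x by rewrite /e subrK.
suff : t^-1 * (f (x + t *: v) - f x) < e by lra.
rewrite mulrC ltr_pdivrMr//.
have -> : e * t = M - f x + e by rewrite /t mulrDr mulrC divfK ?gt_eqF// mulr1.
by lra.
Qed.

Lemma pair_continuous (T U V : topologicalType) (f : T -> U) (g : T -> V) x :
  {for x, continuous f} -> {for x, continuous g} ->
  {for x, continuous (fun y => (f y, g y))}.
Proof. exact: cvg_pair. Qed.

Section finite_coordinates.
Context (R : realType) (E : tvsType R) (A : Type) (Ea : A -> tvsType R).
Hypotheses (sepE : separable_space E) (baireE : baire_space E).
Hypotheses (sepEa : forall a : A, separable_space (Ea a)).
Hypotheses (frechetEa : forall a : A, frechet_space (Ea a)).

Local Notation Y := (sigma_product Ea).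
Local Notation X := (E * sigma_product Ea)%type.
Local Notation P := (prod_topology Ea).

Lemma sigma_val_continuous : continuous (val : Y -> P).
Proof. exact: initial_continuous. Qed.

Lemma coord_continuous a : continuous (fun x : X => val x.2 a).
Proof.
move=> x; apply: (@continuous_comp _ _ _ (fun x : X => val x.2) (fun y : P => y a)).
  apply: (@continuous_comp _ Y P snd val); first exact: cvg_snd.
  exact: sigma_val_continuous.
exact: prod_topology_eval_continuous.
Qed.

Section single.
Variable a : {classic A}.

Let single (e : Ea a) : P := dfwith (fun b : {classic A} => 0 : Ea b) a e.

Let single_sigma e : single e \in sigma_set (E:=Ea).
Proof.
apply/mem_set; apply: (@sub_countable _ _ _ [set a]); last exact: countable1.
apply: subset_card_le => b /= b0; apply: contrapT => /eqP ba.
by move: b0; rewrite /single dfwithout ?eqxx// eq_sym.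
Qed.

Definition sigma_single (e : Ea a) : Y := exist _ (single e) (single_sigma e).

Lemma sigma_singlein e : val (sigma_single e) a = e.
Proof. exact: dfwithin. Qed.

Lemma sigma_singleout e b : b != a -> val (sigma_single e) b = 0.
Proof. by move=> ba; apply: dfwithout; rewrite eq_sym. Qed.

Lemma sigma_single_continuous : continuous sigma_single.
Proof.
apply: (@continuous_comp_initial Y (Ea a) P val) => e.
exact: (@dfwith_continuous {classic A} (fun a => Ea a) _ a).
Qed.

End single.

Lemma coordinates_inj (x y : X) :
  x.1 = y.1 -> (forall a, val x.2 a = val y.2 a) -> x = y.
Proof.
case: x y => [x1 x2] [y1 y2] /= -> H; congr pair.
by apply: val_inj; apply: functional_extensionality_dep.
Qed.

(** [Z] is [E] times the factors indexed by [s], built one factor at a time; [pi] is the projection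
    and [sg] the extension by zero, so [sg (pi x)] truncates [x] to [s]. *)
Lemma finite_coordinates (s : seq {classic A}) :
  exists (Z : tvsType R) (pi : {linear X -> Z}) (sg : {linear Z -> X}),
  [/\ continuous pi /\ continuous sg, cancel sg pi,
      baire_space Z /\ separable_space Z,
      forall x, (sg (pi x)).1 = x.1 /\
        forall a, a \in s -> val (sg (pi x)).2 a = val x.2 a
    & forall z (a : {classic A}), a \notin s -> val (sg z).2 a = 0].
Proof.
elim: s => [|a s [Z [pi [sg [[cpi csg] sgK [bZ sZ] sgpi sg0]]]]].
  have [|pi Hpi] := @linear_wrap R X E fst; first by [].
  have [|sg Hsg] := @linear_wrap R E X (fun e => (e, 0)).
    by move=> c x y; rewrite -[RHS]/(c *: x + y, c *: 0 + 0) scaler0 addr0.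
  exists E, pi, sg; split=> //.
  - split.
      by rewrite (funext Hpi) => x; exact: cvg_fst.
    rewrite (funext Hsg) => x.
    by apply: (@pair_continuous E E Y id (fun=> 0)); [exact: cvg_id|exact: cvg_cst].
  - by move=> e; rewrite Hpi Hsg.
  - by move=> x; rewrite Hsg Hpi.
  - by move=> z a _; rewrite Hsg.
(* A repeated index adds no factor: a doubled coordinate would destroy surjectivity of [pi]. *)
have [as_|as_] := boolP (a \in s).
  exists Z, pi, sg; split=> //.
    move=> x; have [x1 xs] := sgpi x; split=> // b; rewrite inE => /orP[/eqP->|].
      exact: xs.
    exact: xs.
  by move=> z b; rewrite inE negb_or => /andP[_]; exact: sg0.
have pi_single (e : Ea a) : pi (0, sigma_single e : Y) = 0.
  rewrite -[LHS]sgK -[RHS](linear0 pi); congr (pi _).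
  have [x1 xs] := sgpi (0, sigma_single e); apply: coordinates_inj => // b.
  have [bs|bs] := boolP ((b : {classic A}) \in s).
    rewrite xs// -[LHS]/(val (sigma_single e) b) sigma_singleout//.
    by apply/eqP => ba; rewrite ba (negbTE as_) in bs.
  by rewrite sg0.
have [|pi' Hpi'] :=
  @linear_wrap R X (Z * Ea a)%type (fun x => (pi x, val x.2 a)).
  by move=> c x y; rewrite linearP.
have [|sg' Hsg'] :=
    @linear_wrap R (Z * Ea a)%type X (fun z => sg z.1 + (0, sigma_single z.2)).
  move=> c x y /=; rewrite linearP scalerDr addrACA; congr (_ + _).
  apply: coordinates_inj; first by rewrite /= scaler0 addr0.
  move=> b.
  rewrite -[RHS]/(c *: val (sigma_single x.2) b + val (sigma_single y.2) b).
  have [->|ba] := eqVneq (b : {classic A}) a; first by rewrite !sigma_singlein.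
  by rewrite !sigma_singleout// scaler0 addr0.
exists (Z * Ea a)%type, pi', sg'; split.
- split.
    rewrite (funext Hpi') => x.
    apply: (@pair_continuous X Z (Ea a) pi (fun x => val x.2 a)); first exact: cpi.
    exact: coord_continuous.
  rewrite (funext Hsg') => z.
  apply: (@continuous_comp _ _ _
    (fun z : Z * Ea a => (sg z.1, (0, sigma_single z.2) : X))
    (fun u : X * X => u.1 + u.2)); last exact: add_continuous.
  apply: (@pair_continuous (Z * Ea a)%type X X (sg \o fst)
    (fun z => (0, sigma_single z.2))).
    by apply: (@continuous_comp _ Z X fst sg); [exact: cvg_fst|exact: csg].
  apply: (@pair_continuous (Z * Ea a)%type E Y (fun=> 0)
    (fun z => sigma_single z.2)); first exact: cvg_cst.
  by apply: (@continuous_comp _ (Ea a) Y snd (@sigma_single a));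
    [exact: cvg_snd|exact: sigma_single_continuous].
- move=> [z e]; rewrite Hpi' Hsg' linearD pi_single sgK addr0; congr pair.
  rewrite -[LHS]/(val (sg z).2 a + val (sigma_single e) a) sg0//.
  by rewrite sigma_singlein add0r.
- split; last exact: separable_prod.
  exact: baire_prod bZ (frechetEa a) (sepEa a).
- move=> x; have [x1 xs] := sgpi x; rewrite Hpi' Hsg' /= x1 addr0; split=> // b bas.
  rewrite -[LHS]/(val (sg (pi x)).2 b + val (sigma_single (val x.2 a)) b).
  move: bas; have [->|ba] := eqVneq b a; first move=> _.
    by rewrite sg0// add0r sigma_singlein.
  by rewrite inE (negbTE ba) orFb => bs; rewrite xs// sigma_singleout// addr0.
- move=> [z e] b; rewrite inE negb_or Hsg' => /andP[ba bs].
  rewrite -[LHS]/(val (sg z).2 b + val (sigma_single e) b).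
  by rewrite sg0// sigma_singleout// addr0.
Qed.

Lemma nbhs_finite_coordinates (x0 : X) (N : set X) : nbhs x0 N ->
  exists (s : seq {classic A}) (N' : set X), [/\ nbhs x0 N', N' `<=` N &
    forall x y, x.1 = y.1 -> (forall a, a \in s -> val x.2 a = val y.2 a) ->
      N' x -> N' y].
Proof.
(* The sets [N] with the desired property form a filter, and its convergence to [x0] can be checked
   coordinate by coordinate. *)
pose F : set_system X := [set N | exists (s : seq {classic A}) (N' : set X),
  [/\ nbhs x0 N', N' `<=` N &
    forall x y, x.1 = y.1 -> (forall a, a \in s -> val x.2 a = val y.2 a) ->
      N' x -> N' y]].
suff : F --> x0 by exact.
have FF : Filter F.
  split.
  - by exists [::], setT; split=> //; exact: filterT.
  - move=> N1 N2 [s1 [M1 [n1 s1N H1]]] [s2 [M2 [n2 s2N H2]]].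
    exists (s1 ++ s2), (M1 `&` M2); split; first exact: filterI.
      by move=> x [/s1N ? /s2N].
    move=> x y xy H [M1x M2x]; split.
      by apply: H1 xy _ M1x => a as_; apply: H; rewrite mem_cat as_.
    by apply: H2 xy _ M2x => a as_; apply: H; rewrite mem_cat as_ orbT.
  - move=> N1 N2 N12 [s [M [n sN H]]]; exists s, M; split=> //.
    exact: subset_trans N12.
case: x0 @F FF => e0 y0 F FF.
suff : (fun x : X => (x.1, x.2)) @ F --> (e0, y0).
  by rewrite (_ : (fun x : X => (x.1, x.2)) = id)//; apply/funext => -[].
apply: (@cvg_pair X E Y F (nbhs e0) (nbhs y0) FF _ _ fst snd).
  move=> V V0; exists [::], (fst @^-1` V); split=> //; first exact: cvg_fst.
  by move=> x y /= ->.
move=> V [_ [[W oW <-] W0] WV].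
have FP : (fun x : X => val x.2) @ F --> val y0.
  apply: prod_topology_cvg => a V' V'0.
  exists [:: a : {classic A}], ((fun x : X => val x.2 a) @^-1` V'); split=> //.
    exact: (@coord_continuous a (e0, y0) V').
  by move=> x y _ /(_ a); rewrite inE eqxx /= => -> //.
have : F [set x | W (val x.2)] by exact: (FP W (open_nbhs_nbhs (conj oW W0))).
by apply: filterS => x Wx; exact: WV.
Qed.

Lemma generically_gateaux_local (D : set X) (f : X -> R) (x0 : X) :
  open D -> {in D, continuous f} -> convex_function D f -> D x0 ->
  exists U, [/\ open U, U x0, U `<=` D & generically_gateaux D f U].
Proof.
move=> oD ctf cf Dx0.
have ctf' x : D x -> {for x, continuous f} by move=> Dx; exact: (ctf x (mem_set Dx)).
pose N := [set x | D x /\ f x < f x0 + 1].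
have : nbhs x0 N.
  apply: filterI; first exact: open_nbhs_nbhs.
  have lt : f x0 < f x0 + 1 by rewrite ltrDl.
  exact: (@cvgr_lt _ _ _ _ f (f x0) (ctf' x0 Dx0) _ lt).
move=> /nbhs_finite_coordinates[s [N' [nN' N'N satN']]].
have [Z [pi [sg [[cpi csg] sgK [bZ sZ] sgpi sg0]]]] := finite_coordinates s.
have [B cB [oB nB]] := @locally_convex R Z.
have nW' : nbhs (pi x0) [set z | N' (x0 + sg (z - pi x0))].
  have ct : {for pi x0, continuous (fun z => x0 + sg (z - pi x0))}.
    apply: (@continuous_comp _ _ _ (fun z => sg (z - pi x0)) (fun y => x0 + y)).
      apply: (@continuous_comp _ _ _ (fun z => z - pi x0) sg).
        exact: translate_continuous.
      exact: csg.
    rewrite (_ : (fun y => x0 + y) = (fun y => y + x0)); last first.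
      by apply/funext => y; rewrite addrC.
    exact: translate_continuous.
  by apply: (ct N'); rewrite subrr linear0 addr0.
have [W [BW Wx0] WN'] := nB _ _ nW'.
have oW : open W by exact: oB.
have cW : convex_set W by apply: cB; exact: mem_set.
(* [U] is invariant under the kernel of [pi]. Each [x] in [U] agrees with the point
   [x0 + sg (pi x - pi x0)] of [N'] in the [E] component and in the coordinates in [s], hence lies
   in [N]. *)
pose U := pi @^-1` W.
have UN : U `<=` N.
  move=> x /WN' /= H; apply: N'N; apply: satN' H.
    have [x1 _] := sgpi x; have [y1 _] := sgpi x0.
    by rewrite linearB /= x1 y1 addrC subrK.
  move=> a as_; have [_ /(_ a as_) xs] := sgpi x.
  have [_ /(_ a as_) ys] := sgpi x0; rewrite linearB.
  rewrite -[LHS]/(val x0.2 a + (val (sg (pi x)).2 a - val (sg (pi x0)).2 a)).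
  by rewrite xs ys addrC subrK.
have oU : open U by apply: open_comp => // x _; exact: cpi.
have Usg z : W z -> U (sg z) by rewrite /U /= sgK.
have Uker x v (t : R) : U x -> pi v = 0 -> U (x + t *: v).
  by move=> Ux v0; rewrite /U /= linearD linearZ /= v0 scaler0 addr0.
have fker x v : U x -> pi v = 0 -> f (x + v) <= f x.
  move=> Ux v0; apply: (@convex_function_bounded_line R X D f x v (f x0 + 1) cf).
  by move=> t; have [Dt /ltW ft] := UN _ (Uker x v t Ux v0).
have addBK (y z : X) : y + (z - y) = z by rewrite addrC subrK.
(* The difference of [x] and [sg (pi x)] is in the kernel of [pi]; [fker] applied from either point
   gives both inequalities. *)
have fsg x : U x -> f x = f (sg (pi x)).
  move=> Ux; apply/eqP; rewrite eq_le; apply/andP; split.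
    have := fker (sg (pi x)) (x - sg (pi x)); rewrite addBK; apply.
      exact: Usg.
    by rewrite linearB /= sgK subrr.
  have := fker x (sg (pi x) - x); rewrite addBK; apply=> //.
  by rewrite linearB /= sgK subrr.
have [||Q [oO dO gO]] := @mazur R Z W (f \o sg) bZ sZ oW cW.
- apply: convex_functionP => x y t t0 t1 Wx Wy /=; rewrite linearD !linearZ /=.
  by apply: (convex_functionE cf t0 t1); apply: (UN _ _).1; exact: Usg.
- move=> z Wz; apply: continuous_comp; first exact: csg.
  by apply: ctf'; have [] := UN _ (Usg z Wz).
exists U; split=> //; first by move=> x /UN[].
exists (fun n => pi @^-1` Q n); split.
- move=> n; have [oOn OW] := oO n; split; last by move=> x /OW.
  by apply: open_comp => // x _; exact: cpi.
- move=> V oV [x Vx] VU.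
  (* [V] need not be a cylinder, so it is pulled back along the affine section of [pi] through
     [x]. *)
  have oV' : open [set z | V (x + sg (z - pi x))].
    apply: (@open_comp _ _ (fun z => x + sg (z - pi x)) V) => // z _.
    apply: (@continuous_comp _ _ _ (fun z => sg (z - pi x)) (fun y => x + y)).
      apply: (@continuous_comp _ _ _ (fun z => z - pi x) sg).
        exact: translate_continuous.
      exact: csg.
    rewrite (_ : (fun y => x + y) = (fun y => y + x)); last first.
      by apply/funext => y; rewrite addrC.
    exact: translate_continuous.
  have piE z : pi (x + sg (z - pi x)) = z by rewrite linearD /= sgK addrC subrK.
  have [||z [Vz Oz]] := dO _ oV'.
  + by exists (pi x); rewrite /= subrr linear0 addr0.
  + by move=> z /= /VU; rewrite /U /= piE.
  exists (x + sg (z - pi x)); split=> // n _; rewrite /= piE; exact: Oz.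
- move=> x Ox; have [df cdf Hdf] := gO (pi x) Ox.
  (* The quotients of [f] at [x] along [h] are those of [f \o sg] at [pi x] along [pi h]. *)
  exists (df \o pi).
    by move=> y; apply: continuous_comp; [exact: cpi|exact: cdf].
  have Ux : U x by have [_ ] := oO 0%N; apply; exact: Ox.
  move=> h e e0; have [d d0 Hd] := Hdf (pi h) e e0; exists d => // t t0 td.
  have [Wt] := Hd t t0 td.
  have E' : pi x + t *: pi h = pi (x + t *: h) by rewrite linearD linearZ.
  rewrite E' in Wt *; rewrite /= -fsg// -fsg// => lt.
  by split=> //; have [] := UN _ Wt.
Qed.

End finite_coordinates.

Theorem proposition2p5 (R : realType) (E : tvsType R)
    (A : Type) (Ea : A -> tvsType R)
    (hausE : hausdorff_space E) (sepE : separable_space E)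
    (baireE : baire_space E)
    (sepEa : forall a : A, separable_space (Ea a))
    (frechetEa : forall a : A, frechet_space (Ea a)) :
  weak_asplund (E * sigma_product Ea)%type.
Proof.
move=> D D0 oD cD f ctf cf; apply: generically_gateaux_global => // x Dx.
apply: generically_gateaux_local => //.
by rewrite -continuous_open_subspace.
Qed.
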